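(* Let $k\ge 1$ be an integer and let $A=\{y_0,y_1,\dots,y_{2^k-1}\}$ be the finite commutative monoid with $2^k$ elements and operation $\ast$ described in the context. Then for all $a,b\in A$ the Fibonacci sequence $\{a,b\}$ attached to $a,b$ is $t$-stationary for some $t\in\mathbb{N}$.
   Context: For $i\in\{1,\dots,k\}$ let $A_i=\{o_i,x_i\}$ be a two-element totally ordered set with $o_i<x_i$. The set $A=A_1\times\cdots\times A_k$ is totally ordered by the lexicographic order, and its elements are listed in increasing order as $y_0<y_1<\dots<y_{2^k-1}$; one writes $0=y_0=(o_1,\dots,o_k)$ and $1=y_{2^k-1}=(x_1,\dots,x_k)$. The operation $\ast$ on $A$ is given by: $y_i\ast y_j=1$ if $i+j>2^k-1$; $y_i\ast y_j=y_{i+j}$ if $i+j\le 2^k-1$; in particular $y\ast 0=y$ for all $y\in A$. For a commutative monoid $(M,\ast)$ and $a,b\in M$, the Fibonacci sequence attached to $a,b$, denoted $\{a,b\}$, is the sequence $(v_n)_{n\ge 0}$ with $v_0=a$, $v_1=b$ and $v_{n+2}=v_n\ast v_{n+1}$ for $n\in\mathbb{N}$. It is called $t$-stationary (for $t\in\mathbb{N}$) if $v_n=v_{n+1}=v_{n+2}=\cdots$ for all $n\ge t$. *)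

(* Defs.v *)
From HB Require Import structures.
From mathcomp Require Import all_boot all_order.
From mathcomp Require Import zify.

Set Implicit Arguments.
Unset Strict Implicit.
Unset Printing Implicit Defensive.

Import Order.TTheory.

Local Open Scope nat_scope.

(* A commutative monoid is a type M with a [Monoid.com_law e] on it, [e : M]
   being the neutral element. *)
Fixpoint fibonacci (M : Type) (e : M) (op : Monoid.com_law e) (a b : M)
    (n : nat) : M :=
  match n with
  | 0 => a
  | 1 => b
  | (m.+1 as m1).+1 => op (fibonacci op a b m) (fibonacci op a b m1)
  end.

Definition stationary (M : Type) (t : nat) (v : nat -> M) : Prop :=
  forall n m, t <= n -> v (n + m) = v n.

(* Every A_i = {o_i < x_i} is encoded by [bool], with o_i = false < true = x_i;
   [k.-tuplelexi] is the k-fold product with the lexicographic order, the first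
   coordinate being the most significant one. *)
Definition lexcube (k : nat) : finTBOrderType _ := k.-tuplelexi bool.

Section LexCube.
Context {k : nat}.
Implicit Types a b c : lexcube k.

Definition zero : lexcube k := nseq_tuple k false.
Definition one : lexcube k := nseq_tuple k true.

(* [y i] is only meaningful for i <= 2 ^ k - 1; see [y_mono] and [rankK]. *)
Definition y (i : nat) : lexcube k := nth zero (Order.enum (lexcube k)) i.

Definition rank (a : lexcube k) : nat := Order.enum_rank a.

Definition star (a b : lexcube k) : lexcube k :=
  if 2 ^ k - 1 < rank a + rank b then one else y (rank a + rank b).

Lemma card_lexcube : #|lexcube k| = 2 ^ k.
Proof. by rewrite [LHS]card_tuple card_bool. Qed.

Lemma rank_le a : rank a <= 2 ^ k - 1.
Proof.
have : rank a < #|lexcube k| := ltn_ord _.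
by rewrite card_lexcube; lia.
Qed.

Lemma rankK : cancel rank y.
Proof. by move=> a; exact: Order.nth_enum_rank. Qed.

Lemma yK i : i <= 2 ^ k - 1 -> rank (y i) = i.
Proof.
move=> le_i; have lt_i : i < #|lexcube k|.
  by rewrite card_lexcube; have := expn_gt0 2 k; lia.
rewrite /y -[i in nth _ _ i]/(nat_of_ord (Ordinal lt_i)).
by rewrite -Order.enum_val_nth /rank Order.enum_valK.
Qed.

Lemma rank_mono a b : (rank a <= rank b) = (a <= b)%O.
Proof. exact: (Order.le_enum_rank (@le_total _ (lexcube k)) a b). Qed.

Lemma y_mono i j : i <= 2 ^ k - 1 -> j <= 2 ^ k - 1 ->
  (y i <= y j)%O = (i <= j).
Proof. by move=> lei lej; rewrite -rank_mono !yK. Qed.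

Lemma zeroE : zero = \bot%O.
Proof. by apply: eq_from_tnth => i; rewrite tnth_nseq tnth_mktuple. Qed.

Lemma oneE : one = \top%O.
Proof. by apply: eq_from_tnth => i; rewrite tnth_nseq tnth_mktuple. Qed.

Lemma y_first : y 0 = zero.
Proof.
apply/eqP; rewrite zeroE -lex0 -[\bot%O]rankK y_mono ?rank_le //.
Qed.

Lemma y_last : y (2 ^ k - 1) = one.
Proof.
apply/eqP; rewrite oneE -le1x -[\top%O]rankK y_mono ?rank_le //.
Qed.

Lemma rank_star a b : rank (star a b) = minn (rank a + rank b) (2 ^ k - 1).
Proof.
rewrite /star; case: ltnP => le_ab; last by rewrite yK //; lia.
by rewrite -y_last yK //; lia.
Qed.

Lemma star_y i j : i <= 2 ^ k - 1 -> j <= 2 ^ k - 1 ->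
  star (y i) (y j) = if i + j <= 2 ^ k - 1 then y (i + j) else one.
Proof. by move=> lei lej; rewrite /star !yK //; case: leqP. Qed.

Lemma starA : associative star.
Proof.
by move=> a b c; apply: (can_inj rankK); rewrite !rank_star; lia.
Qed.

Lemma starC : commutative star.
Proof. by move=> a b; rewrite /star addnC. Qed.

Lemma star0y : left_id zero star.
Proof.
move=> a; apply: (can_inj rankK); rewrite rank_star -y_first yK //.
by have := rank_le a; lia.
Qed.

HB.instance Definition _ :=
  Monoid.isComLaw.Build (lexcube k) zero star starA starC star0y.

End LexCube.

(* Main.v *)
Require Import Defs.
From mathcomp Require Import all_boot all_order.
From mathcomp Require Import zify.

(** Reading elements of the cube through their rank turns the operation into
    addition truncated at N = 2 ^ k - 1, so the ranks of a Fibonacci sequence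
    form a truncated integer Fibonacci sequence.  If both initial ranks vanish,
    that sequence is identically 0.  Otherwise every rank from index 2 on is
    positive (or N = 0), so each further step adds at least 1 until the
    ceiling N is hit, where the sequence stays: this is
    [truncated_fib_growth].  Ranks determine elements, whence the stationarity
    of the original sequence. *)

Local Open Scope nat_scope.

(** The second component makes the induction work: the increment from index
    [n.+3] to [n.+4] is, below the ceiling, the term
    of index [n.+2], which is at least 1.  The
    linear bound only starts at index 3 because the term of index 1 may be 0,
    as in 1, 0, 1, 1, 2. *)
Lemma truncated_fib_growth (N : nat) (r : nat -> nat) :
    (forall n, r n.+2 = minn (r n + r n.+1) N) -> 0 < r 0 + r 1 ->
  forall n, minn n.+1 N <= r n.+3 /\ minn 1 N <= r n.+2.
Proof.
move=> rE r_gt0; elim=> [|n [IH3 IH2]].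
  by have := rE 0; have := rE 1; lia.
by have := rE n.+2; lia.
Qed.

Lemma truncated_fib_eq0 (N : nat) (r : nat -> nat) :
    (forall n, r n.+2 = minn (r n + r n.+1) N) -> r 0 + r 1 = 0 ->
  forall n, r n = 0.
Proof.
move=> rE r0 n; suff: r n = 0 /\ r n.+1 = 0 by case.
by elim: n => [|n [IH0 IH1]]; [lia | have := rE n; lia].
Qed.

Lemma rank_fibonacci (k : nat) (a b : lexcube k) n :
  rank (fibonacci star a b n.+2) =
  minn (rank (fibonacci star a b n) + rank (fibonacci star a b n.+1))
       (2 ^ k - 1).
Proof. exact: rank_star. Qed.

Lemma stationary_of_rank (k t c : nat) (v : nat -> lexcube k) :
  (forall n, t <= n -> rank (v n) = c) -> stationary t v.
Proof.
move=> vE n m le_tn; apply: (can_inj rankK).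
by rewrite !vE // (leq_trans le_tn) ?leq_addr.
Qed.

Theorem proposition2p4 (k : nat) (hk : 1 <= k) (a b : lexcube k) :
  exists t : nat, stationary t (fibonacci star a b).
Proof.
pose r n := rank (fibonacci star a b n).
have rE n : r n.+2 = minn (r n + r n.+1) (2 ^ k - 1) by exact: rank_fibonacci.
have [r0|r_gt0] := posnP (r 0 + r 1).
  exists 0; apply: (stationary_of_rank _ _ 0) => n _.
  exact: (truncated_fib_eq0 _ r rE r0).
(* At index n.+3 the linear lower bound n.+1 has reached the ceiling as soon as
   n >= 2 ^ k - 1. *)
exists (2 ^ k - 1).+3; apply: (stationary_of_rank _ _ (2 ^ k - 1)).
case=> [|[|[|n]]] // le_n.
have [grow _] := truncated_fib_growth _ r rE r_gt0 n.
by have := rank_le (fibonacci star a b n.+3); rewrite -/(r n.+3); lia.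
Qed.
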